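(* Let $G=(\mathcal N,\mathcal E)$ be a connected symmetric directed graph on $\mathcal N=\{1,\ldots,n\}$ containing all self-arcs $(i,i)$. Let $\mathcal N_i=\{j:(j,i)\in\mathcal E\}$ (which includes $i$), $d_i=|\mathcal N_i|$, and let $A=(a_{ij})$ be given by $a_{ij}=1/d_i$ if $j\in\mathcal N_i$ and $a_{ij}=0$ otherwise. For any $x(0)\in\mathbb R^n$, set $y_i(0)=1/d_i$ and $z_i(0)=x_i(0)/d_i$ for each $i$, run the iterations $y(t+1)=Ay(t)$ and $z(t+1)=Az(t)$, and let $x_i(t)=z_i(t)/y_i(t)$. Then $$\lim_{t\to\infty}x_i(t)=\frac1n\sum_{k=1}^n x_k(0)\qquad\text{for all }i.$$
   Context: A directed graph is symmetric if $(i,j)\in\mathcal E$ if and only if $(j,i)\in\mathcal E$. *)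

(* Defs.v *)
From HB Require Import structures.
From mathcomp Require Import all_boot all_order all_algebra.
From mathcomp Require Import all_classical all_reals all_analysis.

Set Implicit Arguments.
Unset Strict Implicit.
Unset Printing Implicit Defensive.

Import Order.TTheory GRing.Theory Num.Theory.
Import numFieldNormedType.Exports.

Local Open Scope ring_scope.

(* A directed graph on {1, ..., n} is its arc relation E : rel 'I_n, where     *)
(* E j i means that (j, i) is an arc.                                         *)
Definition in_nbrs (n : nat) (E : rel 'I_n) (i : 'I_n) : {set 'I_n} :=
  [set j | E j i].

Definition in_deg (n : nat) (E : rel 'I_n) (i : 'I_n) : nat := #|in_nbrs E i|.

Definition weight_mx (R : realType) (n : nat) (E : rel 'I_n) : 'M[R]_n :=
  \matrix_(i, j) (if j \in in_nbrs E i then (in_deg E i)%:R^-1 else 0).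

Definition y_seq (R : realType) (n : nat) (E : rel 'I_n) (t : nat) : 'cV[R]_n :=
  iter t (mulmx (weight_mx R E)) (\col_i (in_deg E i)%:R^-1).

Definition z_seq (R : realType) (n : nat) (E : rel 'I_n) (x0 : 'cV[R]_n)
    (t : nat) : 'cV[R]_n :=
  iter t (mulmx (weight_mx R E)) (\col_i (x0 i 0 / (in_deg E i)%:R)).

(* The self-arcs make every in_deg E i, hence every entry of y_seq R E t,     *)
(* positive, so the division is genuine and x_seq E x0 0 = x0.                *)
Definition x_seq (R : realType) (n : nat) (E : rel 'I_n) (x0 : 'cV[R]_n)
    (t : nat) : 'cV[R]_n :=
  \col_i (z_seq E x0 t i 0 / y_seq R E t i 0).

(* Main.v *)
Require Import Defs.
From HB Require Import structures.
From mathcomp Require Import all_boot all_order all_algebra.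
From mathcomp Require Import all_classical all_reals all_analysis.

Set Implicit Arguments.
Unset Strict Implicit.
Unset Printing Implicit Defensive.

Import Order.TTheory GRing.Theory Num.Theory.
Import numFieldNormedType.Exports.

Local Open Scope classical_set_scope.
Local Open Scope ring_scope.

(** The matrix A is the transition matrix of the random walk on G.  By
    symmetry of E the degree vector d is stationary: d_i a_ij is the indicator
    of an arc, so sum_i d_i v_i is preserved by v |-> A v
    ([deg_sum_iter]).  If A-iterates of v become constant, the constant is thus
    forced to be (sum_i d_i v_i) / (sum_i d_i).  For the initial vectors of z
    and y the numerators are sum_k x_k(0) and n, and the common denominator
    cancels in the ratio z_i / y_i.

    Convergence comes from a Doeblin minorisation.  By connectedness and the
    self-arcs, any two nodes are joined by a walk of length exactly n, and each
    step of it has weight at least 1/n; so every entry of A^n is at least n^-n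
    ([weight_mx_expn_ge]) and A^n i j >= c d_j for some c > 0.  On
    the hyperplane sum_i d_i v_i = 0 the rank one part c 1 d^T of A^n acts as
    zero, and what is left is a nonnegative matrix with row sums
    1 - c sum_i d_i < 1, so A^n contracts the sup norm ([doeblin_bound]). *)

(** Subtracting the row w from each row of B does not change B v, since w
    annihilates v, and leaves a nonnegative matrix of row sums 1 - sum w. *)
Lemma doeblin_bound (R : realType) (n : nat) (B : 'M[R]_n) (w : 'I_n -> R)
    (v : 'cV[R]_n) (M : R) (i : 'I_n) :
  \sum_j B i j = 1 -> (forall j, w j <= B i j) ->
  \sum_j w j * v j 0 = 0 -> (forall j, `|v j 0| <= M) ->
  `|(B *m v) i 0| <= (1 - \sum_j w j) * M.
Proof.
move=> B1 wB wv vM.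
have -> : (B *m v) i 0 = \sum_j (B i j - w j) * v j 0.
  rewrite mxE -[LHS]subr0 -[X in _ - X]wv -sumrB.
  by apply: eq_bigr => j _; rewrite mulrBl.
rewrite -B1 -sumrB mulr_suml; apply: le_trans (ler_norm_sum _ _ _) _.
apply: ler_sum => j _; rewrite normrM ger0_norm ?subr_ge0//.
by rewrite ler_wpM2l// subr_ge0.
Qed.

Lemma iter_mulmx (R : pzRingType) (n : nat) (A : 'M[R]_n) (v : 'cV[R]_n) t :
  iter t (mulmx A) v = A ^+ t *m v.
Proof.
by elim: t => [|t IH]; rewrite ?expr0 ?mul1mx//= IH exprS -mulmxE mulmxA.
Qed.

Lemma in_deg_gt0 (n : nat) (E : rel 'I_n) (i : 'I_n) :
  E i i -> (0 < in_deg E i)%N.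
Proof. by move=> Eii; apply/card_gt0P; exists i; rewrite inE. Qed.

Lemma in_deg_le (n : nat) (E : rel 'I_n) (i : 'I_n) : (in_deg E i <= n)%N.
Proof. by apply: leq_trans (max_card _) _; rewrite card_ord. Qed.

Lemma weight_mx_ge0 (R : realType) (n : nat) (E : rel 'I_n) (i j : 'I_n) :
  0 <= weight_mx R E i j.
Proof. by rewrite mxE; case: ifP => // _; rewrite invr_ge0. Qed.

Lemma weight_mx_row_sum (R : realType) (n : nat) (E : rel 'I_n) (i : 'I_n) :
  E i i -> \sum_j weight_mx R E i j = 1.
Proof.
move=> Eii; under eq_bigr do rewrite mxE.
rewrite -big_mkcond sumr_const -[_ *+ _]mulr_natl mulfV//.
by rewrite pnatr_eq0 -lt0n in_deg_gt0.
Qed.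

Lemma deg_mul_weight_mx (R : realType) (n : nat) (E : rel 'I_n) (i j : 'I_n) :
  E i i -> (in_deg E i)%:R * weight_mx R E i j = (E j i)%:R.
Proof.
move=> Eii; rewrite mxE inE; case: ifP => _; last by rewrite mulr0.
by rewrite mulfV// pnatr_eq0 -lt0n in_deg_gt0.
Qed.

Lemma weight_mx_arc_ge (R : realType) (n : nat) (E : rel 'I_n) (i j : 'I_n) :
  E i i -> E j i -> n%:R^-1 <= weight_mx R E i j.
Proof.
move=> Eii Eji; rewrite mxE inE Eji lef_pV2 ?posrE ?ltr0n ?in_deg_gt0//.
  by rewrite ler_nat in_deg_le.
by rewrite (leq_trans (in_deg_gt0 Eii)) ?in_deg_le.
Qed.

Lemma deg_sum_mulmx (R : realType) (n : nat) (E : rel 'I_n) (v : 'cV[R]_n) :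
  (forall i j, E i j = E j i) -> (forall i, E i i) ->
  \sum_i (in_deg E i)%:R * (weight_mx R E *m v) i 0 =
  \sum_i (in_deg E i)%:R * v i 0.
Proof.
move=> E_sym E_self.
under eq_bigr do rewrite mxE mulr_sumr.
rewrite exchange_big; apply: eq_bigr => j _.
(* Column j of the arc indicator sums to the out-degree, which E_sym turns
   into the in-degree. *)
under eq_bigr do rewrite mulrA deg_mul_weight_mx// E_sym.
rewrite -mulr_suml -natr_sum; congr (_%:R * _).
rewrite /in_deg -sum1_card [RHS]big_mkcond.
by apply: eq_bigr => i _; rewrite inE; case: (E i j).
Qed.

Lemma deg_sum_iter (R : realType) (n : nat) (E : rel 'I_n) (v : 'cV[R]_n) t :
  (forall i j, E i j = E j i) -> (forall i, E i i) ->
  \sum_i (in_deg E i)%:R * (iter t (mulmx (weight_mx R E)) v) i 0 =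
  \sum_i (in_deg E i)%:R * v i 0.
Proof.
by move=> E_sym E_self; elim: t => //= t IH; rewrite deg_sum_mulmx.
Qed.

Lemma weight_mx_exp_ge0 (R : realType) (n : nat) (E : rel 'I_n) t (i j : 'I_n) :
  0 <= (weight_mx R E ^+ t) i j.
Proof.
elim: t i => [|t IH] i; first by rewrite expr0 mxE ler0n.
rewrite exprS mxE sumr_ge0// => k _.
by rewrite mulr_ge0 ?weight_mx_ge0.
Qed.

Lemma weight_mx_exp_row_sum (R : realType) (n : nat) (E : rel 'I_n) t i :
  (forall i, E i i) -> \sum_j (weight_mx R E ^+ t) i j = 1.
Proof.
move=> E_self; elim: t i => [|t IH] i.
  rewrite expr0 (bigD1 i)//= big1 ?mxE ?eqxx ?addr0// => j ji.
  by rewrite mxE eq_sym (negbTE ji).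
rewrite exprS; under eq_bigr do rewrite mxE.
rewrite exchange_big -(weight_mx_row_sum R (E_self i)).
by apply: eq_bigr => k _; rewrite -mulr_sumr IH mulr1.
Qed.

(** A walk shorter than t is padded with self-arcs at its end, so that only an
    upper bound on its length is needed.  Row i of A is supported on the arcs
    into i whereas a path follows the arcs out of i; symmetry matches the two. *)
Lemma weight_mx_exp_path_ge (R : realType) (n : nat) (E : rel 'I_n) t i p :
  (forall i j, E i j = E j i) -> (forall i, E i i) ->
  path E i p -> (size p <= t)%N ->
  n%:R^-1 ^+ t <= (weight_mx R E ^+ t) i (last i p).
Proof.
move=> E_sym E_self; elim: t i p => [|t IH] i p.
  by case: p => // _ _; rewrite !expr0 mxE eqxx.
have step k j : E i k -> n%:R^-1 ^+ t <= (weight_mx R E ^+ t) k j ->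
    n%:R^-1 ^+ t.+1 <= (weight_mx R E ^+ t.+1) i j.
  move=> Eik kj; rewrite !exprS mxE (bigD1 k)//=.
  rewrite -[leLHS]addr0 lerD// ?ler_pM ?exprn_ge0 ?invr_ge0//.
    by rewrite weight_mx_arc_ge// E_sym.
  by rewrite sumr_ge0// => l _; rewrite mulr_ge0 ?weight_mx_ge0 ?weight_mx_exp_ge0.
case: p => [_ _ /=|k p /= /andP[Eik kp] pt]; first exact/(step i)/(IH i [::]).
exact/(step k)/IH.
Qed.

Lemma weight_mx_expn_ge (R : realType) (n : nat) (E : rel 'I_n) (i j : 'I_n) :
  (forall i j, E i j = E j i) -> (forall i, E i i) ->
  connect E i j -> n%:R^-1 ^+ n <= (weight_mx R E ^+ n) i j.
Proof.
move=> E_sym E_self /connectP[p Ep ->].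
case: (shortenP Ep) => q Eq /card_uniqP q_size _.
apply: weight_mx_exp_path_ge => //.
by apply/ltnW; rewrite -[leqRHS]card_ord -[leqLHS]q_size max_card.
Qed.

Lemma iter_weight_cvg0 (R : realType) (n : nat) (E : rel 'I_n) (v : 'cV[R]_n)
    (i : 'I_n) :
  (forall i j, E i j = E j i) -> (forall i, E i i) ->
  (forall i j, connect E i j) ->
  \sum_i (in_deg E i)%:R * v i 0 = 0 ->
  (fun t => (iter t (mulmx (weight_mx R E)) v) i 0) @ \oo --> 0.
Proof.
move=> E_sym E_self E_conn dv0.
set A := weight_mx R E; set u := fun t => iter t (mulmx A) v.
have n_gt0 : 0 < n%:R :> R by rewrite ltr0n (leq_trans _ (ltn_ord i)).
(* The extra factor 1/n over the lower bound on A^n pays for d_j <= n. *)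
pose c : R := n%:R^-1 ^+ n.+1.
have c_gt0 : 0 < c by rewrite exprn_gt0// invr_gt0.
have minor k j : c * (in_deg E j)%:R <= (A ^+ n) k j.
  apply: le_trans (weight_mx_expn_ge R E_sym E_self (E_conn k j)).
  rewrite /c exprSr -mulrA ler_piMr ?exprn_ge0 ?invr_ge0//.
  by rewrite mulrC ler_pdivrMr// mul1r ler_nat in_deg_le.
pose q : R := 1 - \sum_j c * (in_deg E j)%:R.
have q_ge0 : 0 <= q.
  by rewrite subr_ge0 -[leRHS](weight_mx_exp_row_sum R n i E_self) ler_sum.
have q_lt1 : q < 1.
  rewrite ltrBlDr ltrDl (bigD1 i)//= ltr_pwDl//.
    by rewrite mulr_gt0// ltr0n in_deg_gt0.
  by rewrite sumr_ge0// => j _; rewrite mulr_ge0// ltW.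
have contract s M : (forall j, `|u s j 0| <= M) ->
    forall j, `|u (n + s)%N j 0| <= q * M.
  move=> uM j; rewrite /u iterD iter_mulmx.
  apply: doeblin_bound => //; first exact: weight_mx_exp_row_sum.
  under eq_bigr do rewrite -mulrA.
  by rewrite -mulr_sumr deg_sum_iter// dv0 mulr0.
have nonexp r s M : (forall j, `|u s j 0| <= M) ->
    forall j, `|u (r + s)%N j 0| <= M.
  move=> uM j; rewrite /u iterD iter_mulmx.
  (* The minorisation by the zero row gives the trivial factor 1. *)
  have := @doeblin_bound R n (A ^+ r) (fun=> 0) (u s) M j.
  rewrite big1_eq subr0 mul1r; apply => //; first exact: weight_mx_exp_row_sum.
  - by move=> k; exact: weight_mx_exp_ge0.
  - by rewrite big1// => k _; rewrite mul0r.
pose M0 : R := \sum_j `|v j 0|.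
have geom k : forall j, `|u (k * n)%N j 0| <= q ^+ k * M0.
  elim: k => [|k IH] j; last by rewrite mulSn exprS -mulrA; exact: contract.
  rewrite mul0n expr0 mul1r /u /= /M0 (bigD1 j)//= lerDl.
  by rewrite sumr_ge0.
have q_cvg : (fun k => q ^+ k * M0) @ \oo --> 0.
  rewrite -[X in _ --> X](mul0r M0); apply: cvgMl.
  by apply: cvg_expr; rewrite ger0_norm.
apply/cvgrPdist_le => eps eps_gt0.
have [k _ kP] := (cvgrPdist_le _ _).1 q_cvg _ eps_gt0.
exists (k * n)%N => // t /= kt.
rewrite sub0r normrN -(subnK kt).
apply: nonexp => j; apply: le_trans (geom k j) _.
apply: le_trans (kP k (leqnn k)).
by rewrite sub0r normrN ler_norm.
Qed.

Lemma deg_sum_gt0 (R : realType) (n : nat) (E : rel 'I_n) (i : 'I_n) :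
  E i i -> 0 < \sum_j (in_deg E j)%:R :> R.
Proof.
move=> Eii; rewrite (bigD1 i)//= ltr_pwDl ?ltr0n ?in_deg_gt0//.
by rewrite sumr_ge0.
Qed.

(** Constant vectors are fixed by A, so removing the degree-weighted mean of v
    from all its entries reduces to the case of weighted sum 0. *)
Lemma iter_weight_cvg (R : realType) (n : nat) (E : rel 'I_n) (v : 'cV[R]_n)
    (i : 'I_n) :
  (forall i j, E i j = E j i) -> (forall i, E i i) ->
  (forall i j, connect E i j) ->
  (fun t => (iter t (mulmx (weight_mx R E)) v) i 0) @ \oo -->
    (\sum_j (in_deg E j)%:R * v j 0) / \sum_j (in_deg E j)%:R.
Proof.
move=> E_sym E_self E_conn; set m : R := _ / _.
have D_gt0 := deg_sum_gt0 R (E_self i).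
pose w := v - const_mx m.
have w0 : \sum_j (in_deg E j)%:R * w j 0 = 0.
  under eq_bigr do rewrite !mxE mulrBr.
  by rewrite sumrB -mulr_suml [X in _ - X]mulrC divfK ?subrr// gt_eqF.
have -> : (fun t => iter t (mulmx (weight_mx R E)) v i 0) =
    (fun t => iter t (mulmx (weight_mx R E)) w i 0 + m).
  apply/funext => t; rewrite !iter_mulmx mulmxBr [in RHS]mxE [X in _ + X + _]mxE.
  rewrite [X in _ - X]mxE; under [X in _ - X]eq_bigr do rewrite mxE.
  by rewrite -mulr_suml weight_mx_exp_row_sum// mul1r subrK.
rewrite -[X in _ --> X]add0r; apply: cvgD; last exact: cvg_cst.
exact: iter_weight_cvg0.
Qed.

Theorem mainTheorem8 (R : realType) (n : nat) (E : rel 'I_n)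
    (E_sym : forall i j : 'I_n, E i j = E j i)
    (E_self : forall i : 'I_n, E i i)
    (E_conn : forall i j : 'I_n, connect E i j)
    (x0 : 'cV[R]_n) (i : 'I_n) :
  (fun t : nat => x_seq E x0 t i 0) @ \oo -->
    n%:R^-1 * \sum_(k < n) x0 k 0.
Proof.
have D_neq0 : \sum_j (in_deg E j)%:R != 0 :> R.
  by rewrite gt_eqF// (deg_sum_gt0 R (E_self i)).
have d_neq0 j : (in_deg E j)%:R != 0 :> R by rewrite pnatr_eq0 -lt0n in_deg_gt0.
have n_neq0 : n%:R != 0 :> R by rewrite pnatr_eq0 -lt0n (leq_trans _ (ltn_ord i)).
have z_cvg : (fun t => z_seq E x0 t i 0) @ \oo -->
    (\sum_k x0 k 0) / \sum_j (in_deg E j)%:R.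
  have -> : \sum_k x0 k 0 = \sum_j (in_deg E j)%:R *
      (\col_i (x0 i 0 / (in_deg E i)%:R) : 'cV_n) j 0.
    by apply: eq_bigr => j _; rewrite mxE mulrC divfK.
  exact: iter_weight_cvg.
have y_cvg : (fun t => y_seq R E t i 0) @ \oo -->
    (n%:R / \sum_j (in_deg E j)%:R : R).
  have -> : n%:R = \sum_j (in_deg E j)%:R *
      (\col_i (in_deg E i)%:R^-1 : 'cV[R]_n) j 0.
    under eq_bigr do rewrite mxE mulfV//.
    by rewrite sumr_const card_ord.
  exact: iter_weight_cvg.
have -> : n%:R^-1 * \sum_(k < n) x0 k 0 =
    ((\sum_k x0 k 0) / \sum_j (in_deg E j)%:R) / (n%:R / \sum_j (in_deg E j)%:R).
  by rewrite invf_div mulrA divfK// mulrC.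
under eq_fun do rewrite mxE.
by apply: cvgM => //; apply: cvgV => //; rewrite mulf_neq0 ?invr_neq0.
Qed.
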